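(* Let $G^*$ be a strong, symmetric, noneven digraph with underlying undirected graph $G$. If $G^*$ allows symplectic pairs, then either $G^* = C_2^*$ or $G^* = C_4^*$ (equality meaning digraph isomorphism).
   Context: Digraphs are finite, without loops and without parallel arcs (both arcs $(u,v)$ and $(v,u)$ may be present). A digraph is strong if for every ordered pair of vertices $(u,v)$ there is a directed path from $u$ to $v$. A digraph is symmetric if the existence of arc $(u,v)$ implies the existence of arc $(v,u)$. For an undirected graph $G$, $G^*$ is the symmetric digraph on the same vertex set obtained by replacing each edge $uv$ by the two arcs $(u,v)$ and $(v,u)$; every symmetric digraph is of this form, and $G$ is its underlying undirected graph. $C_k$ ($k>2$) is the undirected cycle of length $k$, and $C_2$ is a single edge joining two vertices. A digraph $D$ is noneven if one can assign a weight in $\{0,1\}$ to each arc so that no directed (simple) cycle of $D$, including cycles of length 2, has even total weight. A sign pattern is a matrix $H$ with entries in $\{0,1,-1\}$; for a real matrix $A$ of the same size, $A\in Q(H)$ means $\operatorname{sgn}(A_{ij})=\operatorname{sgn}(H_{ij})$ for all $i,j$. An $n\times n$ sign pattern $H$ is negative-diagonal if $H_{ii}=-1$ for all $i$. The (unweighted) digraph of an $n\times n$ sign pattern $H$ has vertices $1,\dots,n$ and arc set $\{(i,j): i\ne j,\ H_{ij}\neq 0\}$. The sign pattern $H$ allows symplectic pairs if there are real matrices $A,B\in Q(H)$ with $A^TB=I$. A digraph $D$ allows symplectic pairs if at least one negative-diagonal sign pattern whose digraph is $D$ allows symplectic pairs.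
   Formalization: The formal statement assumes that G has at least two vertices; the one-vertex digraph is strong, symmetric, noneven and allows symplectic pairs (H = A = B = [-1]) but is neither C_2^* nor C_4^*. *)

(* Defs.v *)
From mathcomp Require Import all_boot all_order all_algebra.
From mathcomp Require Import reals.

Set Implicit Arguments.
Unset Strict Implicit.
Unset Printing Implicit Defensive.

Import Order.TTheory GRing.Theory Num.Theory.
Local Open Scope ring_scope.

Record digraph := Digraph {
  dvertex :> finType;
  arc : rel dvertex;
  arc_irrefl : irreflexive arc }.
Arguments arc : clear implicits.

Record ugraph := UGraph {
  uvertex :> finType;
  edge : rel uvertex;
  edge_sym : symmetric edge;
  edge_irrefl : irreflexive edge }.
Arguments edge : clear implicits.

Definition digraph_iso (D1 D2 : digraph) : Prop :=
  exists2 f : D1 -> D2, bijective f &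
    forall u v, arc D2 (f u) (f v) = arc D1 u v.

Definition strong (D : digraph) : Prop := forall u v, connect (arc D) u v.

Definition symmetric_digraph (D : digraph) : Prop :=
  forall u v, arc D u v -> arc D v u.

(* The symmetric digraph G^*. *)
Definition star (G : ugraph) : digraph := Digraph (@edge_irrefl G).

Definition directed_cycle (D : digraph) (c : seq D) : Prop :=
  (1 < size c)%N /\ ucycle (arc D) c.

(* The vertices of c are distinct when this is used, so [next c v] is the
   successor of v on c. *)
Definition cycle_weight (D : digraph) (w : D -> D -> bool) (c : seq D) : nat :=
  (\sum_(v <- c) w v (next c v))%N.

(* The values of the weight w outside the arcs are irrelevant. *)
Definition noneven (D : digraph) : Prop :=
  exists w : D -> D -> bool,
    forall c : seq D, directed_cycle c -> odd (cycle_weight w c).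

Section CycleGraph.
Variable k : nat.

(* [ordS] is the cyclic successor; the two disjuncts coincide for k = 2, which
   gives a single edge. *)
Definition cycle_edge : rel 'I_k :=
  fun i j => (i != j) && ((j == ordS i) || (i == ordS j)).

Lemma cycle_edge_sym : symmetric cycle_edge.
Proof. by move=> i j; rewrite /cycle_edge eq_sym orbC. Qed.

Lemma cycle_edge_irrefl : irreflexive cycle_edge.
Proof. by move=> i; rewrite /cycle_edge eqxx. Qed.

Definition cycle_graph : ugraph := UGraph cycle_edge_sym cycle_edge_irrefl.

End CycleGraph.

Definition sign_pattern m n (H : 'M[int]_(m, n)) : Prop :=
  forall i j, H i j \in [:: 0; 1; -1].

(* A \in Q(H); both signs are compared as integers. *)
Definition in_Q (R : realType) m n (H : 'M[int]_(m, n)) (A : 'M[R]_(m, n))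
  : Prop := forall i j, sgz (A i j) = sgz (H i j).

Definition negative_diagonal n (H : 'M[int]_n) : Prop := forall i, H i i = -1.

Section PatternDigraph.
Variables (n : nat) (H : 'M[int]_n).

Definition pattern_arc : rel 'I_n := fun i j => (i != j) && (H i j != 0).

Lemma pattern_arc_irrefl : irreflexive pattern_arc.
Proof. by move=> i; rewrite /pattern_arc eqxx. Qed.

Definition pattern_digraph : digraph := Digraph pattern_arc_irrefl.

End PatternDigraph.

Definition pattern_allows_symplectic (R : realType) n (H : 'M[int]_n) : Prop :=
  exists A B : 'M[R]_n, [/\ in_Q H A, in_Q H B & A^T *m B = 1%:M].

(* The vertices of D need not be 0, ..., n-1: the isomorphism is a labelling. *)
Definition digraph_allows_symplectic (R : realType) (D : digraph) : Prop :=
  exists n (H : 'M[int]_n),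
    [/\ sign_pattern H, negative_diagonal H,
        digraph_iso (pattern_digraph H) D &
        pattern_allows_symplectic R H].

(* Main.v *)
Require Import Defs.
From mathcomp Require Import all_boot all_order all_algebra.
From mathcomp Require Import reals.

(** Write [w] for a weighting of the arcs of [G^*] that makes every directed
    cycle odd.  On each edge the two arcs have different weights, because they
    form a 2-cycle; hence traversing a closed walk backwards changes its parity
    by its length.  This rules out three configurations in [G].
    - A triangle: its two orientations would have opposite parities
      ([triangle_free]).
    - Two vertices with three common neighbours: for each of the three 4-cycles
      through two of these neighbours the parity is the sum of two of three
      bits, and three bits cannot be pairwise different ([no_three_common]).
    - A 6-cycle with a seventh vertex joined to every second vertex of it:
      adding up the three 4-cycles through the centre gives the parity of the
      6-cycle plus one for each of the three spokes, so the 6-cycle is even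
      ([no_wheel]).

    The symplectic pair enters through its zero pattern.  An off-diagonal entry
    of [A^T B] vanishes, so the sum that defines it cannot have exactly one
    nonzero term; in a triangle-free graph the nonzero terms of entry [(i, j)],
    for nonadjacent [i] and [j], come from the common neighbours of [i] and [j].
    Therefore every path of length two is part of a 4-cycle
    ([symplectic_square]).

    If some vertex had three neighbours, completing the three paths through it
    to 4-cycles would produce one of the last two configurations.  So all
    degrees are at most two ([max_degree_two]).  A connected graph on at least
    two vertices with no vertex of degree two is a single edge, and a 4-cycle
    through a vertex of degree two is closed under adjacency, hence is the whole
    of [G]. *)

Set Implicit Arguments.
Unset Strict Implicit.
Unset Printing Implicit Defensive.

Import Order.TTheory GRing.Theory Num.Theory.

(** * Parities of closed walks *)

Fixpoint walk_parity (T : Type) (w : T -> T -> bool) (x : T) (p : seq T) : bool :=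
  if p is y :: p' then w x y (+) walk_parity w y p' else false.

Lemma odd_sum_next_at (T : eqType) (w : T -> T -> bool) (z y : T) (p : seq T) :
  uniq (y :: p) ->
  odd (\sum_(v <- y :: p) w v (next_at v z y p)) = walk_parity w y (rcons p z).
Proof.
elim: p y => [|x p IHp] y.
  by rewrite big_seq1 /= eqxx oddb addbF.
move=> /andP[y_notin xp_uniq]; rewrite big_cons oddD /= eqxx oddb.
congr (_ (+) _); rewrite -IHp //; congr (odd _).
apply: eq_big_seq => v v_in; congr (nat_of_bool (w v _)).
by case: eqP v_in => // ->; rewrite (negPf y_notin).
Qed.

Definition odd_weighting (G : ugraph) (w : G -> G -> bool) : Prop :=
  forall c : seq (star G), directed_cycle c -> odd (@cycle_weight (star G) w c).

(** Replaces the successor function in [cycle_weight] by a recursion that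
    unfolds on explicit cycles. *)
Lemma odd_cycle_parity (G : ugraph) (w : G -> G -> bool) (x : G) (p : seq G) :
  odd_weighting w -> (0 < size p)%N -> cycle (edge G) (x :: p) ->
  uniq (x :: p) -> walk_parity w x (rcons p x).
Proof.
move=> w_odd p_gt0 xp_cycle xp_uniq; rewrite -odd_sum_next_at //.
by apply: (w_odd (x :: p)); split=> //; apply/andP.
Qed.

(** * Configurations excluded by an odd weighting *)

Section OddWeighting.

Variables (G : ugraph) (w : G -> G -> bool).
Hypothesis w_odd : odd_weighting w.

Lemma edge_neq (u v : G) : edge G u v -> u != v.
Proof. by apply: contraTneq => ->; rewrite edge_irrefl. Qed.

Lemma reverse_weight (u v : G) : edge G u v -> w v u = ~~ w u v.
Proof.
move=> uv; have uv_neq := edge_neq uv.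
have := @odd_cycle_parity G w u [:: v] w_odd isT.
by rewrite /= uv edge_sym uv inE uv_neq => /(_ isT isT); do 2 case: (w _ _).
Qed.

Lemma square_parity (a b c d : G) :
    edge G a b -> edge G b c -> edge G c d -> edge G d a -> a != c -> b != d ->
  w a b (+) (w b c (+) (w c d (+) w d a)).
Proof.
move=> ab bc cd da ac bd.
have := @odd_cycle_parity G w a [:: b; c; d] w_odd isT.
rewrite /= ab bc cd da !inE !negb_or ac bd !edge_neq //= 1?edge_sym //.
by rewrite addbF; apply.
Qed.

Lemma triangle_free (a b c : G) :
  edge G a b -> edge G b c -> edge G a c = false.
Proof.
move=> ab bc; apply/negP => ac.
have := @odd_cycle_parity G w a [:: b; c] w_odd isT.
have := @odd_cycle_parity G w a [:: c; b] w_odd isT.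
rewrite /= ab bc ac edge_sym bc edge_sym ab edge_sym ac !inE !negb_or.
rewrite !edge_neq //= 1?edge_sym // => /(_ isT isT) acb /(_ isT isT).
move: acb; rewrite (reverse_weight bc) (reverse_weight ab) (reverse_weight ac).
by do 3 case: (w _ _).
Qed.

(** With [r t] the sum of [w u t] and [w v t], the 4-cycle through [s] and [t]
    has parity [r s (+) r t]: reversing its second and fourth arcs costs two
    flips, which cancel. *)
Lemma no_three_common (u v a b c : G) :
    u != v -> a != b -> b != c -> a != c ->
    edge G u a -> edge G u b -> edge G u c ->
  edge G v a -> edge G v b -> ~ edge G v c.
Proof.
move=> uv ab bc ac ua ub uc va vb vc.
have rev := @edge_sym G.
have := @square_parity u a v b; rewrite ua vb rev va rev ub => /(_ isT isT isT isT uv ab).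
have := @square_parity u b v c; rewrite ub vc rev vb rev uc => /(_ isT isT isT isT uv bc).
have := @square_parity u a v c; rewrite ua vc rev va rev uc => /(_ isT isT isT isT uv ac).
rewrite !(reverse_weight ua, reverse_weight ub, reverse_weight uc).
rewrite !(reverse_weight va, reverse_weight vb, reverse_weight vc).
by do 6 case: (w _ _).
Qed.

(** In the sum of the three 4-cycles through [v] each spoke is traversed once
    in each direction, so it contributes one; the other arcs form the 6-cycle. *)
Lemma no_wheel (v a b c x y z : G) :
    a != b -> b != c -> a != c -> x != y -> y != z -> x != z ->
    x != v -> y != v -> z != v ->
    edge G v a -> edge G v b -> edge G v c ->
    edge G a x -> edge G x b -> edge G b y -> edge G y c -> edge G c z ->
  ~ edge G z a.
Proof.
move=> ab bc ac xy yz xz xv yv zv va vb vc ax xb b_y yc cz za.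
have rev := @edge_sym G.
(* [neq] separates [a], [b], [c] from [x], [y], [z]: two vertices are distinct
   if only one of them is adjacent to [v]. *)
have neq (s t : G) : edge G v s -> edge G v t = false -> s != t.
  by move=> vs; apply: contraFneq => <-.
have vx : edge G v x = false := triangle_free va ax.
have vy : edge G v y = false := triangle_free vb b_y.
have vz : edge G v z = false := triangle_free vc cz.
have hexagon : w a x (+) (w x b (+) (w b y (+) (w y c (+) (w c z (+) w z a)))).
  have := @odd_cycle_parity G w a [:: x; b; y; c; z] w_odd isT.
  rewrite /= ax xb b_y yc cz za !inE !negb_or addbF; apply=> //.
  rewrite ab bc ac xy yz xz (neq a x) // (neq a y) // (neq a z) // (neq b y) //.
  rewrite (neq b z) // (neq c z) // [x == b]eq_sym [x == c]eq_sym [y == c]eq_sym.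
  by rewrite (neq b x) // (neq c x) // (neq c y).
have := @square_parity v a x b; rewrite va ax xb rev vb eq_sym xv => /(_ isT isT isT isT isT ab).
have := @square_parity v b y c; rewrite vb b_y yc rev vc eq_sym yv => /(_ isT isT isT isT isT bc).
have := @square_parity v c z a; rewrite vc cz za rev va eq_sym zv => /(_ isT isT isT isT isT).
rewrite eq_sym => /(_ ac); move: hexagon.
rewrite (reverse_weight va) (reverse_weight vb) (reverse_weight vc).
by do 9 case: (w _ _).
Qed.

Definition squared : Prop := forall i k j : G,
  edge G i k -> edge G k j -> i != j ->
  exists l, [/\ l != k, edge G i l & edge G l j].

(** Three neighbours [a], [b], [c] of [v] give fourth corners [x], [y], [z] of
    squares on the pairs [a b], [b c], [c a].  If two corners coincide, that
    vertex and [v] share three neighbours; otherwise the corners complete a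
    6-cycle around [v]. *)
Lemma max_degree_two (v a b c : G) :
    squared -> edge G v a -> edge G v b -> a != b -> edge G v c ->
  c = a \/ c = b.
Proof.
move=> sq va vb ab vc.
case: (eqVneq c a) => [|ca]; first by left.
case: (eqVneq c b) => [|cb]; first by right.
have rev := @edge_sym G.
have av : edge G a v by rewrite rev.
have bv : edge G b v by rewrite rev.
have cv : edge G c v by rewrite rev.
have [bc ac] : b != c /\ a != c by rewrite eq_sym cb eq_sym ca.
have [x [xv ax xb]] := sq _ _ _ av vb ab.
have [y [yv b_y yc]] := sq _ _ _ bv vc bc.
have [z [zv cz za]] := sq _ _ _ cv va ca.
have third u : u != v -> edge G a u -> edge G b u -> ~ edge G c u.
  rewrite ![edge G _ u]rev => uv.
  by apply: (@no_three_common v u a b c) => //; rewrite eq_sym.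
have [bx cy az] : [/\ edge G b x, edge G c y & edge G a z] by split; rewrite rev.
have xy : x != y by apply/eqP => E; apply: (third x); rewrite // E.
have yz : y != z by apply/eqP => E; apply: (third z); rewrite // -E.
have xz : x != z by apply/eqP => E; apply: (third x); rewrite // E.
by case: (@no_wheel v a b c x y z).
Qed.

End OddWeighting.

(** * The zero pattern of a symplectic pair *)

(** A lone common neighbour [k] of [i] and [j] would make entry [(i, j)] of
    [A^T B] equal to the single nonzero product [A k i * B k j]. *)
Lemma symplectic_square (R : realType) (G : ugraph) :
    (forall a b c : G, edge G a b -> edge G b c -> edge G a c = false) ->
  digraph_allows_symplectic R (star G) -> squared G.
Proof.
move=> tri_free [n [H [_ _ [f [g fK gK] f_arc] [A [B [AH BH AB1]]]]]].
have f_edge (s t : 'I_n) : edge G (f s) (f t) = (s != t) && (H s t != 0)%R.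
  exact: f_arc.
move=> i' k' j'; rewrite -(gK i') -(gK k') -(gK j').
move: (g i') (g k') (g j') => i k j ik kj; rewrite (can_eq fK) => ij.
apply/'exists_and3P; apply: contraT; rewrite negb_exists => /forallP lone.
have supp (M : 'M[R]_n) s t :
    in_Q H M -> M s t != 0%R -> s = t \/ edge G (f s) (f t).
  move=> /(_ s t) Mst; rewrite -sgz_eq0 Mst sgz_eq0 f_edge => ->.
  by rewrite andbT; case: eqP; [left | right].
have nz (M : 'M[R]_n) s t : in_Q H M -> edge G (f s) (f t) -> M s t != 0%R.
  by move=> /(_ s t) Mst; rewrite f_edge -(sgz_eq0 (M s t)) Mst sgz_eq0 => /andP[].
have nonadj : edge G (f i) (f j) = false := tri_free _ _ _ ik kj.
have := congr1 (fun M : 'M[R]_n => M i j) AB1.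
rewrite /= !mxE (negPf ij) (bigD1 k) //= big1 ?addr0 => [/eqP|l lk].
  rewrite mxE mulf_eq0 (negPf (nz _ _ _ BH kj)) orbF.
  by rewrite (negPf (nz _ _ _ AH _)) // edge_sym.
rewrite mxE; apply/eqP; rewrite mulf_eq0 -[_ || _]negbK negb_or.
apply/negP => /andP[/(supp _ _ _ AH) li /(supp _ _ _ BH) lj].
case: li lj => [->|li] [E|lj].
- by rewrite E eqxx in ij.
- by rewrite lj in nonadj.
- by rewrite -E edge_sym li in nonadj.
- by have := lone (f l); rewrite (can_eq fK) lk edge_sym li lj.
Qed.

(** * Recognising short cycles *)

Lemma iso_cycle_graph (G : ugraph) (k : nat) (x0 : G) (c : seq G) :
    uniq c -> size c = k -> (forall u, u \in c) ->
    (forall i j : 'I_k, edge G (nth x0 c i) (nth x0 c j) = cycle_edge i j) ->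
  digraph_iso (star G) (star (cycle_graph k)).
Proof.
move=> c_uniq c_size c_full c_edge.
have lt_index u : (index u c < k)%N by rewrite -c_size index_mem.
exists (fun u => Ordinal (lt_index u)).
  exists (fun i : 'I_k => nth x0 c i) => [u|i] /=; first by rewrite nth_index.
  by apply: val_inj; rewrite /= index_uniq // c_size.
by move=> u v; rewrite /= -c_edge /= !nth_index.
Qed.

Lemma connected_closed (G : ugraph) (c : seq G) (u : G) :
    strong (star G) -> u \in c ->
    (forall s t, edge G s t -> s \in c -> t \in c) ->
  forall t, t \in c.
Proof.
move=> G_strong uc c_closed t.
have G_sym : connect_sym (edge G) by apply: sym_connect_sym; apply: edge_sym.
by rewrite -(closed_connect (intro_closed G_sym c_closed) (G_strong u t)).
Qed.

Lemma iso_edge (G : ugraph) (u v : G) :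
    strong (star G) -> edge G u v ->
    (forall s t t', edge G s t -> edge G s t' -> t = t') ->
  digraph_iso (star G) (star (cycle_graph 2)).
Proof.
move=> G_strong uv deg1.
have vu : edge G v u by rewrite edge_sym.
apply: (@iso_cycle_graph G 2 u [:: u; v]) => //.
- by rewrite /= inE edge_neq.
- apply: (connected_closed G_strong (mem_head u _)) => s t st.
  by rewrite !inE => /orP[/eqP E|/eqP E]; rewrite E in st;
    rewrite ?(deg1 _ _ _ st uv) ?(deg1 _ _ _ st vu) eqxx ?orbT.
- by do 2 (case; case=> [|[|//]] ?); rewrite /= ?edge_irrefl ?uv ?vu.
Qed.

Lemma iso_square (G : ugraph) (v a x b : G) :
    strong (star G) ->
    (forall s t t' t'' : G, edge G s t -> edge G s t' -> t != t' ->
       edge G s t'' -> t'' = t \/ t'' = t') ->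
    edge G v x = false -> edge G a b = false -> v != x -> a != b ->
    edge G v a -> edge G a x -> edge G x b -> edge G b v ->
  digraph_iso (star G) (star (cycle_graph 4)).
Proof.
move=> G_strong deg2 nvx nab vx ab va ax xb bv.
have rev := @edge_sym G.
have [av xa bx vb] : [/\ edge G a v, edge G x a, edge G b x & edge G v b].
  by split; rewrite rev.
apply: (@iso_cycle_graph G 4 v [:: v; a; x; b]) => //.
- by rewrite /= !inE !negb_or vx ab !edge_neq.
- apply: (connected_closed G_strong (mem_head v _)) => s t st.
  rewrite !inE => /or4P[] /eqP E; rewrite E in st.
  + by case: (deg2 _ _ _ _ va vb ab st) => ->; rewrite eqxx ?orbT.
  + by case: (deg2 _ _ _ _ av ax vx st) => ->; rewrite eqxx ?orbT.
  + by case: (deg2 _ _ _ _ xa xb ab st) => ->; rewrite eqxx ?orbT.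
  + by case: (deg2 _ _ _ _ bv bx vx st) => ->; rewrite eqxx ?orbT.
- do 2 (case; case=> [|[|[|[|//]]]] ?); rewrite /= ?edge_irrefl //.
  all: by rewrite ?(va, ax, xb, bv, av, xa, bx, vb, nvx, nab) // rev ?nvx ?nab.
Qed.

(** * The classification *)

Theorem theorem4p2 (R : realType) (G : ugraph)
  (hnontrivial : 1 < #|G|)
  (hstrong : strong (star G))
  (hsym : symmetric_digraph (star G))
  (hnoneven : noneven (star G))
  (hallows : digraph_allows_symplectic R (star G)) :
  digraph_iso (star G) (star (cycle_graph 2)) \/
  digraph_iso (star G) (star (cycle_graph 4)).
Proof.
have [w w_odd] := hnoneven.
have {}w_odd : odd_weighting w := w_odd.
have tri_free := triangle_free w_odd.
have sq := symplectic_square tri_free hallows.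
have deg2 := fun s t t' t'' st st' tt' =>
  @max_degree_two G w w_odd s t t' t'' sq st st' tt'.
have rev := @edge_sym G.
case: (boolP [exists v, exists a, exists b,
               [&& edge G v a, edge G v b & a != b]]).
  move=> /existsP[v /existsP[a /existsP[b /and3P[va vb ab]]]]; right.
  have av : edge G a v by rewrite rev.
  have bv : edge G b v by rewrite rev.
  have [x [xv ax xb]] := sq _ _ _ av vb ab.
  apply: (@iso_square G v a x b) => //; first exact: tri_free va ax.
    exact: tri_free av vb.
  by rewrite eq_sym.
move=> /existsPn deg1; left.
have {}deg1 s t t' : edge G s t -> edge G s t' -> t = t'.
  move=> st st'; apply/eqP; apply: contraT => tt'; case/existsP: (deg1 s).
  by exists t; apply/existsP; exists t'; rewrite st st'.
have /card_gt1P[u [t [_ _ ut]]] := hnontrivial.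
have /connectP[[|v p] /= uv_path t_last] := hstrong u t.
  by rewrite t_last eqxx in ut.
by case/andP: uv_path => uv _; apply: (iso_edge hstrong uv).
Qed.
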